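(* Let $L_n^k$ denote the associated Laguerre polynomials, $D$ differentiation, $X$ multiplication by $x$, and $C=D-1$. Then for all integers $n,k\ge 0$ (with $n\ge1$ in those identities in which the index $n-1$ occurs) the following relations hold. (i) Three term recurrence relation: $$(2n+1+k-X)L_n^k=(n+1)L_{n+1}^k+(n+k)L_{n-1}^k.$$ (ii) Three-point-rules: $$L_n^k=\tfrac1n(n+k+1+XC)L_{n-1}^{k+1}-L_{n-1}^{k+1}=L_n^{k+1}-L_{n-1}^{k+1},$$ $$nL_n^k=(n+k+XC)L_{n-1}^k=(n+k)L_{n-1}^k-XL_{n-1}^{k+1},$$ $$kL_n^k=(k+XC)L_n^k-XC\,L_n^k=(n+1)L_{n+1}^{k-1}+XL_n^{k+1},$$ $$(n-X)L_n^k=XC\,L_n^k+(n-XD)L_n^k=-XL_n^{k+1}+(n+k)L_{n-1}^k.$$ (iii) Sheffer sequence: $$DL_n^k=-L_{n-1}^{k+1}=(D-1)L_{n-1}^k.$$ (iv) Reflection across the main diagonal $k=0$: $$L_{n+k}^{-k}=\frac{n!}{(n+k)!}\,(-X)^kL_n^k.$$ (v) Rodrigues formula: $$L_n^k(x)=\frac1{n!}X^{-k}C^n\,x^{n+k},$$ that is, for $x>0$, $$L_n^k(x)=\frac1{n!}\,x^{-k}e^x\,\frac{d^n}{dx^n}\bigl(e^{-x}x^{n+k}\bigr).$$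
   Context: For $n\in\mathbb N_0$ and $k\in\mathbb Z$ the associated Laguerre polynomial is $$L_n^k(x)=\sum_{j=0}^n\binom{n+k}{n-j}\frac{(-1)^j}{j!}x^j,$$ where $\binom{a}{i}=a(a-1)\cdots(a-i+1)/i!$. The operators act on smooth functions of $x$: $D=d/dx$, $X$ is multiplication by $x$ (considered invertible by restricting to $x>0$ where negative powers of $X$ are used), and $C=D-1$. *)

(* Defs.v *)
From HB Require Import structures.
From mathcomp Require Import all_boot all_order all_algebra.
From mathcomp Require Import all_classical all_reals all_analysis.
Set Implicit Arguments.
Unset Strict Implicit.
Unset Printing Implicit Defensive.
Import Order.TTheory GRing.Theory Num.Theory.
Import numFieldNormedType.Exports.
Local Open Scope ring_scope.

(* The library's 'C(a, i) only allows a natural number a; here a may be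
   negative. *)
Definition gbinom (R : realType) (a : R) (i : nat) : R :=
  (\prod_(m < i) (a - m%:R)) / i`!%:R.

Definition laguerre (R : realType) (n : nat) (k : int) : R -> R := fun x =>
  \sum_(j < n.+1) gbinom (n%:Z + k)%:~R (n - j)%N * ((-1) ^+ j / j`!%:R) * x ^+ j.

(* derive1 is total, with an unspecified value where the derivative does not
   exist; the operators below are meant to be applied to smooth functions. *)
Definition opD (R : realType) (f : R -> R) : R -> R := f^`()%classic.

Definition opX (R : realType) (f : R -> R) : R -> R := fun x => x * f x.

Definition opC (R : realType) (f : R -> R) : R -> R := opD f - f.

(* Main.v *)
(** As polynomials in [x], the [L_n^k] with [k : int] satisfy three identities,
    read off coefficientwise from Pascal's rule and the absorption identity
    for generalized binomials:
    [L_{n+1}^k = L_{n+1}^{k+1} - L_n^{k+1}], [D L_{n+1}^k = - L_n^{k+1}] and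
    [(n+1) L_{n+1}^k = (n+1+k) L_n^k - x L_n^{k+1}].
    The first two give [C L_n^k = - L_n^{k+1}], and (i)-(iii) are linear
    combinations.  The reflection formula compares factorials.  Rodrigues'
    formula [C^n x^(n+k) = n! x^k L_n^k] is an induction on [n] for all [k],
    applying the induction hypothesis at [k+1]; its second form conjugates by
    the exponential, since [D (e^{-x} f) = e^{-x} C f]. *)
Require Import Defs.
From HB Require Import structures.
From mathcomp Require Import all_boot all_order all_algebra.
From mathcomp Require Import all_classical all_reals all_analysis.
From mathcomp Require Import ring zify.
Set Implicit Arguments.
Unset Strict Implicit.
Unset Printing Implicit Defensive.
Import Order.TTheory GRing.Theory Num.Theory.
Import numFieldNormedType.Exports.
Local Open Scope ring_scope.

(** * Generalized binomial coefficients *)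

Lemma gbinom0 (R : realType) (a : R) : gbinom a 0 = 1.
Proof. by rewrite /gbinom big_ord0 fact0 divr1. Qed.

Lemma factr_neq0 (R : realType) (n : nat) : n`!%:R != 0 :> R.
Proof. by rewrite pnatr_eq0 -lt0n fact_gt0. Qed.

Lemma gbinomSr (R : realType) (a : R) (i : nat) :
  i.+1%:R * gbinom a i.+1 = (a - i%:R) * gbinom a i.
Proof.
rewrite /gbinom big_ord_recr /= factS natrM.
by field; rewrite factr_neq0 nat1r pnatr_eq0.
Qed.

(** Absorption: once the first factor [a + 1] is split off, the remaining factors, shifted by one,
    are those of [gbinom a i]. *)
Lemma gbinomSS (R : realType) (a : R) (i : nat) :
  i.+1%:R * gbinom (a + 1) i.+1 = (a + 1) * gbinom a i.
Proof.
rewrite /gbinom big_ord_recl /= subr0 factS natrM.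
under eq_bigr => m _ do rewrite /bump add1n -natr1 opprD addrACA subrr addr0.
by field; rewrite factr_neq0 nat1r pnatr_eq0.
Qed.

Lemma gbinom_pascal (R : realType) (a : R) (i : nat) :
  gbinom (a + 1) i.+1 = gbinom a i.+1 + gbinom a i.
Proof.
have i0 : i.+1%:R != 0 :> R by rewrite pnatr_eq0.
apply: (mulfI i0); rewrite mulrDr gbinomSS gbinomSr -natr1; ring.
Qed.

Lemma gbinom_nat (R : realType) (n i : nat) : gbinom n%:R i = 'C(n, i)%:R :> R.
Proof.
elim: n i => [|n IHn] [|i]; rewrite ?gbinom0 ?bin0 //.
  by rewrite /gbinom big_ord_recl subrr mul0r mul0r bin0n.
by rewrite -natr1 gbinom_pascal !IHn binS natrD.
Qed.

(** * Laguerre polynomials as formal polynomials, compared coefficient by coefficient *)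

Definition laguerre_poly (R : realType) (n : nat) (k : int) : {poly R} :=
  \poly_(j < n.+1)
    (gbinom (n%:Z + k)%:~R (n - j)%N * ((-1) ^+ j / j`!%:R)).

Lemma laguerreE (R : realType) (n : nat) (k : int) :
  laguerre n k = horner (laguerre_poly R n k).
Proof. by apply/funext => x; rewrite horner_poly. Qed.

Lemma laguerre_poly0 (R : realType) (k : int) : laguerre_poly R 0 k = 1.
Proof.
apply/polyP => -[|j]; rewrite coef_poly coef1 //=.
by rewrite gbinom0 fact0 divr1 mulr1.
Qed.

Lemma laguerre_poly_pascal (R : realType) (n : nat) (k : int) :
  laguerre_poly R n.+1 k
  = laguerre_poly R n.+1 (k + 1) - laguerre_poly R n (k + 1).
Proof.
apply/polyP => j; rewrite coefB !coef_poly !ltnS.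
have -> : n.+1%:Z + (k + 1) = (n.+1%:Z + k) + 1 by rewrite addrA.
have -> : n%:Z + (k + 1) = n.+1%:Z + k by lia.
rewrite [(_ + 1)%:~R]intrD.
case: ltngtP => [lt_jn|lt_nj|->].
- by rewrite -ltnS lt_jn subSn // gbinom_pascal; ring.
- by rewrite leqNgt (ltnW lt_nj) subr0.
(* At [j = n + 1] only the two leading coefficients remain, and they agree. *)
- by rewrite ltnn subnn !gbinom0; ring.
Qed.

Lemma deriv_laguerre_poly (R : realType) (n : nat) (k : int) :
  (laguerre_poly R n.+1 k)^`() = - laguerre_poly R n (k + 1).
Proof.
apply/polyP => j; rewrite coef_deriv coefN !coef_poly !ltnS.
have -> : n.+1%:Z + k = n%:Z + (k + 1) by lia.
case: leqP => // _; rewrite ?mul0rn ?oppr0 //.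
rewrite subSS exprS factS natrM -mulr_natr.
by field; rewrite factr_neq0 nat1r pnatr_eq0.
Qed.

Lemma deriv_laguerre_polyB (R : realType) (n : nat) (k : int) :
  (laguerre_poly R n k)^`() - laguerre_poly R n k
  = - laguerre_poly R n (k + 1).
Proof.
case: n => [|n]; first by rewrite !laguerre_poly0 derivC sub0r.
by rewrite deriv_laguerre_poly laguerre_poly_pascal; ring.
Qed.

(** In the coefficient of [x^j], split [n + 1 = (n + 1 - j) + j]: absorption turns the first part
    into the [L_n^k] term, and [j / j! = 1 / (j - 1)!] turns the second into the [x L_n^(k+1)]
    term. *)
Lemma laguerre_poly_rec (R : realType) (n : nat) (k : int) :
  n.+1%:R *: laguerre_poly R n.+1 k
  = (n.+1%:Z + k)%:~R *: laguerre_poly R n k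
    - 'X * laguerre_poly R n (k + 1).
Proof.
apply/polyP => j; rewrite coefB !coefZ coefXM !coef_poly !ltnS.
have -> : n%:Z + (k + 1) = n.+1%:Z + k by lia.
have e : (n.+1%:Z + k)%:~R = (n%:Z + k)%:~R + 1 :> R.
  by rewrite -[1]/(1%:~R) -intrD; congr (_%:~R); lia.
have abs (i : nat) : (i <= n)%N ->
  (n.+1%:R - i%:R) * gbinom ((n.+1%:Z + k)%:~R : R) (n.+1 - i)%N
  = (n.+1%:Z + k)%:~R * gbinom ((n%:Z + k)%:~R : R) (n - i)%N.
  by move=> le_in; rewrite -natrB 1?leqW // subSn // e gbinomSS.
case: j => [|j] /=.
  have := abs 0%N (leq0n n); rewrite !subn0 subr0 => h.
  by rewrite (mulrA _ (gbinom _ _)) h; ring.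
rewrite subSS exprS factS natrM.
have j0 : j.+1%:R != 0 :> R by rewrite pnatr_eq0.
case: (ltngtP j n) => [lt_jn|lt_nj|->].
- have := abs _ lt_jn; rewrite subSS => h.
  rewrite ltnS (ltnW lt_jn) [in RHS](mulrA _ (gbinom _ _)) -h.
  by field; rewrite factr_neq0 nat1r pnatr_eq0.
- by rewrite ltnS leqNgt lt_nj !mulr0 subr0.
(* Top coefficient, of degree [n + 1]: [L_n^k] contributes nothing. *)
- rewrite ltnSn subnn !gbinom0.
  by field; rewrite factr_neq0 nat1r pnatr_eq0.
Qed.

(** On the left the upper binomial index is [(n + k) - k = n], a natural number, so every
    coefficient below degree [k] vanishes. *)
Lemma laguerre_poly_reflection (R : realType) (n k : nat) :
  laguerre_poly R (n + k) (- k%:Z)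
  = (n`!%:R / (n + k)`!%:R) *: ((- 'X) ^+ k * laguerre_poly R n k).
Proof.
apply/polyP => j.
rewrite coefZ exprNn -mulrA mulrCA coefXnM -polyC1 -polyCN -polyC_exp coefCM.
rewrite !coef_poly PoszD addrK -pmulrn -[_ + k%:Z]/((n + k)%N%:Z) -pmulrn.
rewrite !ltnS !gbinom_nat.
case: (ltnP j k) => [lt_jk|le_kj].
  rewrite bin_small; last by lia.
  by case: ifP; rewrite ?mul0r !mulr0.
have [i ->] : exists i, j = (i + k)%N by exists (j - k)%N; rewrite subnK.
rewrite addnK leq_add2r; case: leqP => le_in; last by rewrite !mulr0.
rewrite subnDr (bin_sub le_in).
(* Expanding [n!] and [(n + k)!] through the two binomials that occur leaves only factors that
   cancel. *)
have hn : n`!%:R = ('C(n, i) * (i`! * (n - i)`!))%N%:R :> R by rewrite bin_fact.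
have hnk : (n + k)`!%:R
    = ('C(n + k, n - i) * ((n - i)`! * (i + k)`!))%N%:R :> R.
  by rewrite (_ : (i + k)%N = (n + k - (n - i))%N) ?bin_fact //; lia.
rewrite hn hnk !natrM exprD.
by field; rewrite !factr_neq0 pnatr_eq0 -lt0n bin_gt0; lia.
Qed.

(** * Transfer from formal polynomials to functions *)

Lemma opD_horner (R : realType) (p : {poly R}) : opD (horner p) = horner p^`().
Proof. by apply/funext => x; rewrite /opD derive1E derive_val. Qed.

Lemma opC_horner (R : realType) (p : {poly R}) :
  opC (horner p) = horner (p^`() - p).
Proof.
by rewrite /opC opD_horner; apply/funext => x; rewrite hornerD hornerN.
Qed.

Lemma iter_opC_horner (R : realType) (n : nat) (p : {poly R}) :
  iter n (@opC R) (horner p) = horner (iter n (fun q => q^`() - q) p).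
Proof. by elim: n => //= n ->; rewrite opC_horner. Qed.

Lemma laguerre_pascal (R : realType) (n : nat) (k : int) (x : R) :
  laguerre n.+1 k x = laguerre n.+1 (k + 1) x - laguerre n (k + 1) x.
Proof. by rewrite !laguerreE laguerre_poly_pascal hornerD hornerN. Qed.

Lemma laguerre_rec (R : realType) (n : nat) (k : int) (x : R) :
  n.+1%:R * laguerre n.+1 k x
  = (n.+1%:Z + k)%:~R * laguerre n k x - x * laguerre n (k + 1) x.
Proof.
have /(congr1 (fun p => p.[x])) := laguerre_poly_rec R n k.
by rewrite !laguerreE !hornerE.
Qed.

Lemma opD_laguerre (R : realType) (n : nat) (k : int) :
  opD (laguerre n.+1 k) = - laguerre (R := R) n (k + 1).
Proof.
rewrite !laguerreE opD_horner deriv_laguerre_poly.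
by apply/funext => x; rewrite hornerN.
Qed.

Lemma opC_laguerre (R : realType) (n : nat) (k : int) :
  opC (laguerre n k) = - laguerre (R := R) n (k + 1).
Proof.
rewrite !laguerreE opC_horner deriv_laguerre_polyB.
by apply/funext => x; rewrite hornerN.
Qed.

(** * Rodrigues formula, for polynomials and in exponential form *)

Lemma laguerre_poly_rodrigues (R : realType) (n k : nat) :
  iter n (fun q : {poly R} => q^`() - q) 'X^(n + k)
  = n`!%:R *: ('X^k * laguerre_poly R n k).
Proof.
elim: n k => [|n IHn] k; first by rewrite laguerre_poly0 mulr1 fact0 scale1r.
have ek : k.+1%:Z = k%:Z + 1 by lia.
have -> : n.+1`!%:R *: ('X^k * laguerre_poly R n.+1 k)
          = n`!%:R *: ('X^k * (n.+1%:R *: laguerre_poly R n.+1 k)).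
  by rewrite factS natrM -scalerAr scalerA mulrC.
(* Reading [(n + 1) + k] as [n + (k + 1)] lets the induction hypothesis apply at [k + 1]; one
   application of [C] remains. *)
rewrite iterS addSnnS IHn derivZ -scalerBr ek; congr (_ *: _).
(* Both sides are reduced to combinations of [L_n^(k+1)] and [L_n^(k+2)]. *)
rewrite laguerre_poly_pascal scalerBr laguerre_poly_rec.
rewrite derivM derivXn -pred_Sn.
have /eqP := deriv_laguerre_polyB R n (k%:Z + 1); rewrite subr_eq => /eqP ->.
have -> : (n.+1%:Z + (k%:Z + 1))%:~R = n.+1%:R + k.+1%:R :> R.
  by rewrite -natrD pmulrn; congr (_%:~R); lia.
rewrite -!mul_polyC rmorphD /= !polyC_natr -mulr_natr exprS; ring.
Qed.

Lemma derive1n_expRN_horner (R : realType) (n : nat) (p : {poly R}) :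
  (fun y => expR (- y) * p.[y])^`(n)%classic
  = fun y => expR (- y) * (iter n (fun q => q^`() - q) p).[y].
Proof.
elim: n => [|n IHn]; first by rewrite derive1n0.
rewrite derive1nS IHn iterS; set q := iter n _ p.
apply/funext => y; rewrite derive1E derive_val.
rewrite hornerD hornerN /= /GRing.scale /=.
ring.
Qed.

(** * The relations (i)-(v), derived pointwise *)

Theorem theorem5 (R : realType) (n k : nat) :
  let L : nat -> int -> R -> R := @laguerre R in
  let D : (R -> R) -> (R -> R) := @opD R in
  let X : (R -> R) -> (R -> R) := @opX R in
  let C : (R -> R) -> (R -> R) := @opC R in
  (* (i) *)
  ((0 < n)%N ->
     (2 * n + 1 + k)%:R *: L n k - X (L n k)
     = n.+1%:R *: L n.+1 k + (n + k)%:R *: L n.-1 k)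
  (* (ii) *)
  /\ ((0 < n)%N ->
        L n k = n%:R^-1 *: ((n + k + 1)%:R *: L n.-1 (k%:Z + 1)
                            + X (C (L n.-1 (k%:Z + 1))))
                - L n.-1 (k%:Z + 1)
     /\ n%:R^-1 *: ((n + k + 1)%:R *: L n.-1 (k%:Z + 1)
                    + X (C (L n.-1 (k%:Z + 1))))
          - L n.-1 (k%:Z + 1)
        = L n (k%:Z + 1) - L n.-1 (k%:Z + 1))
  /\ ((0 < n)%N ->
        n%:R *: L n k = (n + k)%:R *: L n.-1 k + X (C (L n.-1 k))
     /\ (n + k)%:R *: L n.-1 k + X (C (L n.-1 k))
        = (n + k)%:R *: L n.-1 k - X (L n.-1 (k%:Z + 1)))
  /\ (k%:R *: L n k = (k%:R *: L n k + X (C (L n k))) - X (C (L n k))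
     /\ (k%:R *: L n k + X (C (L n k))) - X (C (L n k))
        = n.+1%:R *: L n.+1 (k%:Z - 1) + X (L n (k%:Z + 1)))
  /\ (n%:R *: L n k - X (L n k)
        = X (C (L n k)) + (n%:R *: L n k - X (D (L n k)))
     /\ ((0 < n)%N ->
          X (C (L n k)) + (n%:R *: L n k - X (D (L n k)))
          = - X (L n (k%:Z + 1)) + (n + k)%:R *: L n.-1 k))
  (* (iii) *)
  /\ ((0 < n)%N ->
        D (L n k) = - L n.-1 (k%:Z + 1)
     /\ - L n.-1 (k%:Z + 1) = D (L n.-1 k) - L n.-1 k)
  (* (iv) *)
  /\ (L (n + k)%N (- k%:Z)
      = (n`!%:R / (n + k)`!%:R) *: iter k (fun f => - X f) (L n k))
  (* (v) *)
  /\ (forall x : R, 0 < x ->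
        L n k x = n`!%:R^-1 * (x ^- k * iter n C (fun y => y ^+ (n + k)) x)
     /\ L n k x = n`!%:R^-1 * x ^- k * expR x
                  * (fun y => expR (- y) * y ^+ (n + k))^`(n)%classic x).
Proof.
move=> L D X C.
have XE f x : X f x = x * f x by [].
have CE j l : C (L j l) = - L j (l + 1) by exact: opC_laguerre.
have DE j l : D (L j.+1 l) = - L j (l + 1) by exact: opD_laguerre.
have DCE f : D f = C f + f by rewrite /C /opC subrK.
have pascal j l x : L j.+1 l x = L j.+1 (l + 1) x - L j (l + 1) x.
  exact: laguerre_pascal.
(* For a natural upper index the integer coefficient computes to a cast from [nat]. *)
have rec j l x : j.+1%:R * L j.+1 (Posz l) x
    = (j.+1 + l)%:R * L j l x - x * L j (l%:Z + 1) x.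
  exact: laguerre_rec.
split.
  case: n => // m _ /=; apply/funext => x; rewrite !fctE XE /GRing.scale /=.
  (* The recurrence at [n] and at [n - 1] gives the sum [(2n+1+k) L_n^k - x (L_n^(k+1) -
     L_(n-1)^(k+1))], whose bracket is [L_n^k]. *)
  rewrite rec.
  have -> : (m.+1 + k)%:R * L m k x
      = m.+1%:R * L m.+1 k x + x * L m (k%:Z + 1) x by rewrite rec; ring.
  rewrite pascal; ring.
split.
  case: n => // m _ /=.
  (* Since [C] raises the upper index with a sign, this is the recurrence at [k + 1]. *)
  have -> : m.+1%:R^-1 *: ((m.+1 + k + 1)%:R *: L m (k%:Z + 1)
              + X (C (L m (k%:Z + 1)))) = L m.+1 (k%:Z + 1).
    apply/funext => x; rewrite !fctE XE CE !fctE /GRing.scale /= mulrN.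
    by rewrite -addnA -rec mulKf ?pnatr_eq0.
  by split=> //; apply/funext => x; rewrite !fctE pascal.
split.
  case: n => // m _ /=; split; apply/funext => x;
    by rewrite !fctE !XE CE !fctE /GRing.scale /= mulrN ?rec.
split.
  split; first by rewrite addrK.
  apply/funext => x; rewrite !fctE !XE CE !fctE /GRing.scale /= addrK.
  (* The index [k - 1] may be [-1], so [pascal] first raises it to [k], where [rec] applies. *)
  rewrite pascal subrK mulrBr rec; ring.
split.
  split.
    apply/funext => x; rewrite DCE !fctE !XE ?fctE /GRing.scale /=; ring.
  case: n => // m _ /=.
  apply/funext => x; rewrite CE DE !fctE !XE ?fctE /GRing.scale /= rec; ring.
split.
  case: n => // m _ /=; split; first exact: DE.
  by rewrite DCE addrK CE.
split.
  have iterE j f x : iter j (fun f => - X f) f x = (- x) ^+ j * f x.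
    elim: j => [|j IHj]; first by rewrite mul1r.
    by rewrite iterS fctE XE IHj exprS; ring.
  apply/funext => x; rewrite fctE iterE /L !laguerreE.
  rewrite laguerre_poly_reflection.
  by rewrite hornerZ hornerM horner_exp hornerN hornerX.
move=> x x_gt0.
have xk0 : x ^+ k != 0 by rewrite expf_neq0 // gt_eqF.
have XnE : (fun y : R => y ^+ (n + k)) = horner 'X^(n + k).
  by apply/funext => y; rewrite hornerXn.
split.
  rewrite XnE iter_opC_horner laguerre_poly_rodrigues.
  rewrite /L laguerreE hornerZ hornerM hornerXn.
  by field; rewrite xk0 factr_neq0.
have -> : (fun y => expR (- y) * y ^+ (n + k))
          = (fun y => expR (- y) * ('X^(n + k) : {poly R}).[y]).
  by apply/funext => y; rewrite hornerXn.
rewrite derive1n_expRN_horner laguerre_poly_rodrigues expRN.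
rewrite /L laguerreE hornerZ hornerM hornerXn.
by field; rewrite xk0 factr_neq0 gt_eqF ?expR_gt0.
Qed.
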